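(* Let $\mathcal B$ be a preordered barycentric algebra, let $p\colon\mathcal B\to\overline{\mathbb R}_+$ be convex and $q\colon\mathcal B\to\overline{\mathbb R}_+$ be concave, such that for all $x,y\in\mathcal B$ with $x\le y$, $q(x)\le p(y)$ (for example, if $q\le p$ pointwise and $p$ or $q$ is monotonic). Then there is an affine monotonic map $\Lambda\colon\mathcal B\to\overline{\mathbb R}_+$ such that $q\le\Lambda\le p$. If $\mathcal B$ is a preordered pointed barycentric algebra and $p$ is strict (for example, sublinear), then $\Lambda$ is linear.
   Context: $\overline{\mathbb R}_+=[0,\infty]$ with its usual order, addition and multiplication ($0\cdot\infty=0$). A barycentric algebra is a set $\mathcal B$ with operations $+_a$, $a\in[0,1]$, such that $x+_1y=x$, $x+_ax=x$, $x+_ay=y+_{1-a}x$, and $(x+_ay)+_bz=x+_{ab}(y+_{\frac{(1-a)b}{1-ab}}z)$ if $a<1$, $b<1$. It is preordered if it has a preordering $\le$ such that every $+_a$ is monotonic in both arguments. A preordered pointed barycentric algebra is a preordered barycentric algebra with a distinguished element $\bot$ that is a least element; then $a\cdot x:=x+_a\bot$ for $a\in[0,1]$. A map $f\colon\mathcal B\to\overline{\mathbb R}_+$ is affine (resp. concave, convex) if $f(x+_ay)=af(x)+(1-a)f(y)$ (resp. $\ge$, $\le$) for all $x,y\in\mathcal B$, $a\in[0,1]$. In the pointed case, $f$ is strict if $f(\bot)=0$, $\mathbb I$-homogeneous if $f(a\cdot x)=af(x)$ for all $a\in[0,1]$, linear (resp. sublinear) if $\mathbb I$-homogeneous and affine (resp.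 convex). *)

(* Defs.v *)
From HB Require Import structures.
From mathcomp Require Import all_boot all_order all_algebra.
From mathcomp Require Import interval_inference reals ereal convex.

Set Implicit Arguments.
Unset Strict Implicit.
Unset Printing Implicit Defensive.

Import Order.TTheory GRing.Theory Num.Theory.
Local Open Scope ring_scope.
Local Open Scope ereal_scope.
Local Open Scope convex_scope.

(* A barycentric algebra is a [convType R]: [x +_a y] is [x <| a |> y], where
   [a : {i01 R}] is the weight of [x]. The library states the associativity
   axiom without division, for all weights; its instances where one of the two
   weights in [(x +_a y) +_b z] is 1 follow from the other axioms. *)

HB.mixin Record isPreorderedBarycentric (d : Order.disp_t) (R : numDomainType) T
    of ConvexSpace R T & Order.Preorder d T := {
  conv_mono : forall (a : {i01 R}) (x x' y y' : T),
    (x <= x')%O -> (y <= y')%O -> (x <| a |> y <= x' <| a |> y')%O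
}.

#[short(type=preorderedBaryType)]
HB.structure Definition PreorderedBarycentric (d : Order.disp_t)
    (R : numDomainType) :=
  {T of ConvexSpace R T & Order.Preorder d T & isPreorderedBarycentric d R T}.

(* The extended nonnegative reals are the nonnegative elements of [\bar R],
   in which [0 * +oo = 0]; the notions below are meant for maps [f] such that
   [forall x, 0 <= f x]. *)

Section maps.
Context {R : realType} {B : convType R}.
Implicit Types (f : B -> \bar R) (bot : B).

Definition affine_map f : Prop := forall (a : {i01 R}) (x y : B),
  f (x <| a |> y) = a%:num%:E * f x + (1 - a%:num)%:E * f y.

Definition convex_map f : Prop := forall (a : {i01 R}) (x y : B),
  f (x <| a |> y) <= a%:num%:E * f x + (1 - a%:num)%:E * f y.

Definition concave_map f : Prop := forall (a : {i01 R}) (x y : B),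
  a%:num%:E * f x + (1 - a%:num)%:E * f y <= f (x <| a |> y).

Definition strict_map bot f : Prop := f bot = 0.

Definition pscale bot (a : {i01 R}) (x : B) : B := x <| a |> bot.

Definition I_homogeneous bot f : Prop := forall (a : {i01 R}) (x : B),
  f (pscale bot a x) = a%:num%:E * f x.

Definition linear_map bot f : Prop := I_homogeneous bot f /\ affine_map f.

Definition sublinear_map bot f : Prop := I_homogeneous bot f /\ convex_map f.

End maps.

(* Least elements of a preorder need not be unique: the distinguished element
   of a pointed algebra is passed explicitly. *)
Definition is_least (d : Order.disp_t) (T : preorderType d) (bot : T) : Prop :=
  forall x : T, (bot <= x)%O.

Definition dominated (d : Order.disp_t) (T : preorderType d) (R : realType)
    (q p : T -> \bar R) : Prop :=
  forall x y : T, (x <= y)%O -> q x <= p y.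

(* Main.v *)
Require Import Defs.
From mathcomp Require Import all_boot all_order all_algebra.
From mathcomp Require Import interval_inference reals ereal convex.
From mathcomp Require Import boolp classical_sets ring lra.
Import Order.TTheory GRing.Theory Num.Theory.

(** Consider the convex maps [f] with [q x <= f y] whenever [x <= y]. An infimum
    of a chain of such maps is again one, so by Zorn's lemma there is a minimal
    one [f] below [p] ([exists_minimal_convex_majorant]). This [f] is the map
    sought: minimality alone makes it monotonic and affine.

    The tool is [shadow f z r], for a point [z] and a real [r >= 0]. Regard the
    pair [(z, r)] as a source of light: a point [(x, v)] is in the shadow of the
    epigraph of [f] if the segment from [(z, r)] to [(x, v)] meets the epigraph
    (closed downwards along the preorder) at a point other than [(z, r)]. The
    lower boundary of the shadow is a convex map below [f]. If it dominates [q],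
    it must be equal to [f] by minimality, which gives
    [a f(x) + (1 - a) r <= f w] whenever [x +_a z <= w] and [a > 0]; and it
    dominates [q] as soon as the same inequality holds with [q x] in place of
    [f x] ([minimal_majorant_supports]). This is used for three values of [r].
    - With [r = 0] and [a = 1] the conclusion is that [f] is monotonic.
    - With [r = q z], the concavity of [q] is the premise, and the conclusion is
      [a f(x) + (1 - a) q(z) <= f (x +_a z)].
    - With [r = f z], the previous inequality, with the two points exchanged, is
      the premise, and the conclusion is the concavity of [f].
    Where [q z] or [f z] is infinite, the inequalities hold because their right
    hand sides are infinite too: for [q z] this follows from the concavity of
    [q], for [f z] from the second inequality. In the pointed case,
    [0 <= f bot <= p bot = 0], so that homogeneity is affinity at [bot]. *)

Local Open Scope ereal_scope.

(** * Identities in barycentric algebras *)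

Section barycentric_identities.
Local Open Scope ring_scope.
Local Open Scope convex_scope.
Context {R : realType} {B : convType R}.
Implicit Types (a b c : {i01 R}) (x y z : B).

Lemma i01P a : [\/ a = 0%:i01, a = 1%:i01 | 0 < a%:num < 1].
Proof.
have [->|a0] := eqVneq a 0%:i01; first by constructor 1.
have [->|a1] := eqVneq a 1%:i01; first by constructor 2.
constructor 3; apply/andP; split.
- by rewrite lt_neqAle eq_sym a0/=.
- by rewrite lt_neqAle a1/=.
Qed.

Lemma i01_ex (r : R) : 0 <= r -> r <= 1 -> exists a, a%:num = r.
Proof. by move=> r0 r1; exists (Itv01 r0 r1). Qed.

(** The associativity axiom can be read backwards only when its outer weight [c]
    is not 1; otherwise both weights are 1. *)
Lemma conv_absorb a b c x z :
  c%:num = a%:num * b%:num -> (x <| a |> z) <| b |> z = x <| c |> z.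
Proof.
move=> cab.
have [a1 b1 c1] : [/\ a%:num <= 1, b%:num <= 1 & c%:num <= 1 :> R] by [].
have [a0 b0 c0] : [/\ 0 <= a%:num, 0 <= b%:num & 0 <= c%:num :> R] by [].
have [c1'|] := eqVneq c%:num (1 : R).
  have aE : a%:num = 1 :> R by nra.
  have bE : b%:num = 1 :> R by nra.
  have -> : a = 1%:i01 by apply/val_inj.
  have -> : b = 1%:i01 by apply/val_inj.
  have -> : c = 1%:i01 by apply/val_inj.
  by rewrite !conv1.
move=> cn1; have clt1 : 0 < 1 - c%:num :> R.
  by rewrite subr_gt0 lt_neqAle cn1.
have cb : c%:num <= b%:num :> R by nra.
have [q qE] : exists q : {i01 R}, q%:num = 1 - (1 - b%:num) / (1 - c%:num).
  apply: i01_ex.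
  - by rewrite subr_ge0 ler_pdivrMr// mul1r lerD2l lerN2.
  - by rewrite gerBl divr_ge0 ?subr_ge0.
rewrite -(convA c q) ?convmm//= /unstable.onem qE.
by field; rewrite gt_eqF.
Qed.

(** Both sides are the barycentre of [x1], [x2] and [z] with the same weights.
    As the algebra need not be cancellative, the equation has to be derived from
    the axioms, by gathering the two copies of [z]. *)
Lemma conv_common_point a1 a2 a b c x1 x2 z :
    0 < b%:num < 1 -> 0 < c%:num < 1 ->
    c%:num * a1%:num = b%:num * a%:num ->
    (1 - c%:num) * a2%:num = (1 - b%:num) * a%:num ->
  (x1 <| a1 |> z) <| c |> (x2 <| a2 |> z) = (x1 <| b |> x2) <| a |> z.
Proof.
move=> /andP[b0 b1] /andP[c0 c1] e1 e2.
have [a10 a11] : 0 <= a1%:num /\ a1%:num <= 1 :> R by [].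
have [a20 a21] : 0 <= a2%:num /\ a2%:num <= 1 :> R by [].
have [a0 a1'] : 0 <= a%:num /\ a%:num <= 1 :> R by [].
have [p pE] : exists p : {i01 R}, p%:num = b%:num * a%:num.
  by apply: i01_ex; nra.
have p1 : 0 < 1 - p%:num :> R by rewrite pE; nra.
have [q qE] : exists q : {i01 R}, q%:num = 1 - (1 - c%:num) / (1 - p%:num).
  apply: i01_ex.
  - by rewrite subr_ge0 ler_pdivrMr// mul1r pE; nra.
  - by rewrite gerBl divr_ge0 ?subr_ge0.
have [u uE] : exists u : {i01 R}, u%:num = (1 - b%:num) * a%:num / (1 - p%:num).
  apply: i01_ex.
  - by rewrite divr_ge0 ?mulr_ge0 ?subr_ge0.
  - by rewrite ler_pdivrMr// mul1r pE; nra.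
have pn0 : 1 - p%:num != 0 :> R by rewrite gt_eqF.
(* The left side becomes x1 +_p (z +_q (x2 +_a2 z)), then x1 +_p (x2 +_u z). *)
rewrite -(convA p q); last 2 first.
- by rewrite pE -e1 mulrC.
- by rewrite /unstable.onem qE; field.
rewrite (convC q) (conv_absorb _ _ u); last first.
  by rewrite uE/= qE -e2; field.
by apply: convA; rewrite ?pE// /unstable.onem uE -?pE//; field: pE.
Qed.

End barycentric_identities.

(** * Convex maps as lower boundaries of convex sets *)

Section envelopes.
Local Open Scope classical_set_scope.
Local Open Scope convex_scope.
Context {R : realType} {B : convType R}.
Implicit Types (S : B -> set R) (f : B -> \bar R).

Lemma ge0_addeMy (u : \bar R) (t : R) :
  0 <= u -> (0 < t)%R -> u + t%:E * +oo = +oo.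
Proof. by move=> u0 t0; rewrite gt0_muley ?lte_fin//; case: u u0. Qed.

(** Only real heights are used, so that all computations in [S] are finite; an
    infinite value of the envelope arises from an empty fibre. *)
Definition lower_envelope S x : \bar R := ereal_inf (EFin @` S x).

Lemma lower_envelope_le S x (v : R) : S x v -> lower_envelope S x <= v%:E.
Proof. by move=> Sv; apply: ereal_inf_lbound; exists v. Qed.

Lemma le_lower_envelope S x (m : \bar R) :
  (forall v, S x v -> m <= v%:E) -> m <= lower_envelope S x.
Proof. by move=> h; apply: le_ereal_inf_tmp => _ [v Sv <-]; exact: h. Qed.

Lemma convex_mapW f :
  (forall (a : {i01 R}) x y, (0 < a%:num < 1)%R ->
    f (x <| a |> y) <= a%:num%:E * f x + (1 - a%:num)%:E * f y) ->
  convex_map f.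
Proof.
move=> h a x y; have [->|->|] := i01P a; last exact: h.
- by rewrite conv0 /= mul0e add0e subr0 mul1e.
- by rewrite conv1 /= mul1e subrr mul0e adde0.
Qed.

Lemma concave_mapW f :
  (forall (a : {i01 R}) x y, (0 < a%:num < 1)%R ->
    a%:num%:E * f x + (1 - a%:num)%:E * f y <= f (x <| a |> y)) ->
  concave_map f.
Proof.
move=> h a x y; have [->|->|] := i01P a; last exact: h.
- by rewrite conv0 /= mul0e add0e subr0 mul1e.
- by rewrite conv1 /= mul1e subrr mul0e adde0.
Qed.

(** At the weights 0 and 1 convexity is an identity. Strictly between them an
    empty fibre makes the right hand side infinite, and otherwise heights in [S]
    that are close to both infima can be combined. *)
Lemma convex_lower_envelope S :
    (forall x v, S x v -> 0 <= v)%R ->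
    (forall (a : {i01 R}) x y v w, (0 < a%:num < 1)%R -> S x v -> S y w ->
      S (x <| a |> y) (a%:num * v + (1 - a%:num) * w)%R) ->
  convex_map (lower_envelope S).
Proof.
move=> S0 Sconv; apply: convex_mapW => a x y /andP[a0 a1].
have b0 : (0 < 1 - a%:num :> R)%R by rewrite subr_gt0.
have env0 z : 0 <= lower_envelope S z.
  by apply: le_lower_envelope => v /S0.
have near z (e : R) m : (0 < e)%R -> lower_envelope S z = m%:E ->
    exists2 v, S z v & (v < m + e)%R.
  move=> e0 zm; have : lower_envelope S z < (m + e)%:E.
    by rewrite zm lte_fin ltrDl.
  by case/ereal_inf_lt => _ [v Sv <-]; rewrite lte_fin; exists v.
have := env0 x; have := env0 y.
case Ex : (lower_envelope S x) => [m| |]//; last first.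
  by move=> y0 _; rewrite addeC ge0_addeMy ?leey ?mule_ge0 ?lee_fin ?(ltW b0).
case Ey : (lower_envelope S y) => [n| |]// _ _; last first.
  by rewrite gt0_muley ?lte_fin// addey ?leey.
apply/lee_addgt0Pr => e e0.
have [v Sv vm] := near _ _ _ e0 Ex; have [w Sw wn] := near _ _ _ e0 Ey.
have a01 : (0 < a%:num < 1)%R by rewrite a0.
have := lower_envelope_le S _ _ (Sconv _ _ _ _ _ a01 Sv Sw).
move=> /le_trans; apply.
rewrite -!EFinM -!EFinD lee_fin.
have : (a%:num * v <= a%:num * (m + e))%R by rewrite ler_pM2l// ltW.
have : ((1 - a%:num) * w <= (1 - a%:num) * (n + e))%R by rewrite ler_pM2l// ltW.
by lra.
Qed.

End envelopes.

(** * Minimal convex majorants *)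

Section minimal_majorant.
Local Open Scope classical_set_scope.
Local Open Scope convex_scope.
Context {R : realType} {d : Order.disp_t} {B : preorderedBaryType d R}.
Variable q : B -> \bar R.
Hypothesis q_ge0 : forall x, 0 <= q x.
Hypothesis q_concave : concave_map q.
Implicit Types (f : B -> \bar R) (x y z w : B) (a b c : {i01 R}).

Definition convex_majorant f := convex_map f /\ dominated q f.

Definition minimal_convex_majorant f :=
  convex_majorant f /\
  forall g, convex_majorant g -> (forall x, g x <= f x) ->
    forall x, f x <= g x.

Lemma convex_majorant_ge f x : convex_majorant f -> q x <= f x.
Proof. by move=> [_]; apply. Qed.

Lemma convex_majorant_ge0 f x : convex_majorant f -> 0 <= f x.
Proof. by move=> fm; exact: le_trans (q_ge0 x) (convex_majorant_ge f x fm). Qed.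

(** Zorn's lemma applies because the union of a chain of convex epigraphs is
    convex: two points of the union lie in a common member of the chain. *)
Lemma exists_minimal_convex_majorant p : convex_majorant p ->
  exists2 f, minimal_convex_majorant f & forall x, f x <= p x.
Proof.
move=> p_maj.
pose T := {f | convex_majorant f /\ forall x, f x <= p x}.
pose t0 : T := exist _ p (conj p_maj (fun x => lexx (p x))).
pose below (f g : T) := `[< forall x, sval g x <= sval f x >].
have [| | |f fmin] := @ZL_preorder T t0 below.
- by move=> f; apply/asboolP => x.
- move=> f g h /asboolP fg /asboolP gh; apply/asboolP => x.
  exact: le_trans (gh x) (fg x).
- move=> A Atot.
  (* Adding the top element makes the chain nonempty. *)
  pose A' := [set f : T | f = t0 \/ A f].
  have A'tot : total_on A' below.
    have t0l (f : T) : below t0 f by apply/asboolP; case: (svalP f).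
    by move=> f g [->|Af] [->|Ag]; [left|left|right|exact: Atot].
  pose S x := [set v : R | exists2 f, A' f & sval f x <= v%:E].
  have S0 x v : S x v -> (0 <= v)%R.
    case=> f _; rewrite -lee_fin; apply: le_trans.
    by apply: convex_majorant_ge0; case: (svalP f).
  have Sle x (f : T) : A' f -> lower_envelope S x <= sval f x.
    move=> A'f; have := convex_majorant_ge0 _ x (svalP f).1.
    case E : (sval f x) => [v| |]// _; last exact: leey.
    by apply: lower_envelope_le; exists f; rewrite ?E.
  have gP : convex_majorant (lower_envelope S) /\
      forall x, lower_envelope S x <= p x.
    split; last by move=> x; apply: (Sle x t0); left.
    split; last first.
      move=> x y xy; apply: le_lower_envelope => v [f _]; apply: le_trans.
      by apply: (svalP f).1.2.
    apply: convex_lower_envelope => // a x y v w /andP[a0 a1].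
    have b0 : (0 < 1 - a%:num :> R)%R by rewrite subr_gt0.
    have SS (f : T) : A' f -> sval f x <= v%:E -> sval f y <= w%:E ->
        S (x <| a |> y) (a%:num * v + (1 - a%:num) * w)%R.
      move=> A'f fv fw; exists f => //; apply: le_trans ((svalP f).1.1 _ _ _) _.
      by rewrite [leRHS]EFinD !EFinM leeD// lee_pmul2l ?lte_fin.
    move=> [f A'f fv] [g A'g gw].
    have [/asboolP fg|/asboolP gf] := A'tot _ _ A'f A'g.
    + by apply: (SS g) => //; exact: le_trans (fg x) fv.
    + by apply: (SS f) => //; exact: le_trans (gf y) gw.
  exists (exist _ (lower_envelope S) gP : T) => f Af; apply/asboolP => x.
  by apply: Sle; right.
have [fmaj fp] := svalP f.
exists (sval f) => //; split=> // g gmaj gf.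
have gP : convex_majorant g /\ forall x, g x <= p x.
  by split=> // x; exact: le_trans (gf x) (fp x).
have := fmin (exist _ g gP : T); rewrite /below/= => h.
by apply/asboolP; apply: h; apply/asboolP.
Qed.

(** The lower boundary of the points [(x, v)] with [v >= 0] whose segment to
    [(z, r)] meets the epigraph of [f], up to the preorder, at a point with
    weight [a > 0] on [(x, v)]. With real arithmetic it would be the infimum of
    [(f w - (1 - a) r) / a] over [a > 0] and [w] above [x +_a z]. *)
Definition shadow f z (r : R) : B -> \bar R :=
  lower_envelope (fun x => [set v : R | (0 <= v)%R /\
    exists a w, [/\ (0 < a%:num)%R, (x <| a |> z <= w)%O &
      f w <= (a%:num * v + (1 - a%:num) * r)%:E]]).

Lemma shadow_le f z r x : 0 <= f x -> shadow f z r x <= f x.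
Proof.
case E : (f x) => [v| |]// v0; last exact: leey.
apply: lower_envelope_le; split; first by rewrite -lee_fin.
exists (1%:i01)%R, x; split; rewrite //= ?conv1//.
by rewrite E lee_fin mul1r subrr mul0r addr0.
Qed.

(** If two points are in the shadow because of points of the epigraph over [w1]
    and [w2], their combination is so because of a suitable point over the
    segment from [w1] to [w2]. *)
Lemma convex_shadow f z r : convex_map f -> convex_map (shadow f z r).
Proof.
move=> fconv; apply: convex_lower_envelope; first by move=> x v [].
move=> b x1 x2 v1 v2 /andP[b0 b1] [v10 [a1 [w1 [a10 le1 f1]]]]
  [v20 [a2 [w2 [a20 le2 f2]]]].
have b'0 : (0 < 1 - b%:num :> R)%R by rewrite subr_gt0.
split; first by rewrite addr_ge0// mulr_ge0// ltW.
have [a11 a21] : (a1%:num <= 1)%R /\ (a2%:num <= 1)%R by [].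
(* The weights c and a are the solution of c a1 = b a, (1 - c) a2 = (1 - b) a:
   they say where the segment from w1 to w2 crosses the one from the combination
   of x1 and x2 to z. *)
set D : R := (b%:num * a2%:num + (1 - b%:num) * a1%:num)%R.
have D0 : (0 < D)%R by rewrite addr_gt0// mulr_gt0.
have [c cE] : exists c : {i01 R}, (c%:num = b%:num * a2%:num / D)%R.
  apply: i01_ex; first by rewrite divr_ge0 ?mulr_ge0 ?ltW.
  by rewrite ler_pdivrMr// mul1r lerDl mulr_ge0 ?ltW.
have [a aE] : exists a : {i01 R}, (a%:num = a1%:num * a2%:num / D)%R.
  apply: i01_ex; first by rewrite divr_ge0 ?mulr_ge0 ?ltW.
  have h1 : (b%:num * (a1%:num * a2%:num) <= b%:num * a2%:num)%R.
    by rewrite ler_wpM2l// ler_piMl.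
  have h2 : ((1 - b%:num) * (a1%:num * a2%:num) <= (1 - b%:num) * a1%:num)%R.
    by rewrite ler_wpM2l ?ler_piMr// ltW.
  by rewrite ler_pdivrMr// mul1r /D; lra.
have c0 : (0 < c%:num :> R)%R by rewrite cE divr_gt0 ?mulr_gt0.
have c1 : (c%:num < 1 :> R)%R.
  by rewrite cE ltr_pdivrMr// mul1r ltrDl mulr_gt0.
have c'0 : (0 < 1 - c%:num :> R)%R by rewrite subr_gt0.
have e1 : (c%:num * a1%:num = b%:num * a%:num :> R)%R by rewrite cE aE; ring.
have e2 : ((1 - c%:num) * a2%:num = (1 - b%:num) * a%:num :> R)%R.
  by rewrite cE aE /D; field; rewrite gt_eqF.
exists a, (w1 <| c |> w2); split.
- by rewrite aE divr_gt0 ?mulr_gt0.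
- rewrite -(conv_common_point a1 a2 a b c) ?b0 ?c0//.
  exact: conv_mono.
apply: le_trans (fconv _ _ _) _.
have -> : (a%:num * (b%:num * v1 + (1 - b%:num) * v2) + (1 - a%:num) * r =
   c%:num * (a1%:num * v1 + (1 - a1%:num) * r) +
   (1 - c%:num) * (a2%:num * v2 + (1 - a2%:num) * r))%R.
  have -> : (a%:num * (b%:num * v1 + (1 - b%:num) * v2) + (1 - a%:num) * r =
    b%:num * a%:num * (v1 - r) + (1 - b%:num) * a%:num * (v2 - r) + r)%R by ring.
  by rewrite -e1 -e2; ring.
by rewrite [leRHS]EFinD !EFinM leeD// lee_pmul2l ?lte_fin// -EFinM -EFinD.
Qed.

(** The premise says that the shadow dominates [q]; by minimality the shadow is
    then [f], and the conclusion says that [f] is below its shadow. *)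
Lemma minimal_majorant_supports f z (r : R) :
    minimal_convex_majorant f -> (0 <= r)%R ->
    (forall a x w, (0 < a%:num)%R -> (x <| a |> z <= w)%O ->
      a%:num%:E * q x + ((1 - a%:num) * r)%:E <= f w) ->
  forall a x w, (0 < a%:num)%R -> (x <| a |> z <= w)%O ->
    a%:num%:E * f x + ((1 - a%:num) * r)%:E <= f w.
Proof.
move=> [fmaj fmin] r0 qf a x w a0 xzw.
have shadow_maj : convex_majorant (shadow f z r).
  split; first exact: convex_shadow fmaj.1.
  move=> x' y x'y; apply: le_lower_envelope => v [v0 [b [u [b0 yu fu]]]].
  have : b%:num%:E * q x' + ((1 - b%:num) * r)%:E <=
         b%:num%:E * v%:E + ((1 - b%:num) * r)%:E.
    rewrite -[leRHS]EFinD; apply: le_trans fu; apply: qf => //.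
    by apply: le_trans yu; exact: conv_mono.
  by rewrite leeD2rE// lee_pmul2l// lte_fin.
have f_le : f x <= shadow f z r x.
  apply: fmin => // y; apply: shadow_le; exact: convex_majorant_ge0.
have := qf a x w a0 xzw.
have : 0 <= f w by exact: convex_majorant_ge0.
case Ew : (f w) => [t| |]// _; last by move=> _; rewrite leey.
move=> qt.
have rt : ((1 - a%:num) * r <= t)%R.
  rewrite -lee_fin; apply: le_trans qt; rewrite leeDr// mule_ge0//.
have : f x <= ((t - (1 - a%:num) * r) / a%:num)%:E.
  apply: le_trans f_le _; apply: lower_envelope_le; split.
    by rewrite divr_ge0 ?subr_ge0.
  exists a, w; split=> //; rewrite Ew lee_fin.
  by rewrite mulrC divfK ?subrK// gt_eqF.
rewrite -(lee_pmul2l (x := a%:num%:E))// ?lte_fin// -EFinM mulrC.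
by rewrite divfK ?gt_eqF// EFinB leeBrDr.
Qed.

Lemma minimal_majorant_nondecreasing f :
  minimal_convex_majorant f -> Order.nondecreasing f.
Proof.
move=> fmin x y xy.
have := minimal_majorant_supports f x 0%R fmin (lexx _).
move=> /(_ _ (1%:i01)%R x y); rewrite /= mul1e mulr0 adde0 conv1; apply=> //.
move=> a x' w a0 xw; rewrite mulr0 adde0.
apply: le_trans (fmin.1.2 _ _ xw); apply: le_trans (q_concave a x' x).
by rewrite leeDl// mule_ge0// lee_fin subr_ge0.
Qed.

(** Halfway to concavity: the value at one of the two points is still that of
    [q]. It settles the concavity of [f] at points of infinite value. *)
Lemma minimal_majorant_conv_ge f a x z :
    minimal_convex_majorant f -> (0 < a%:num)%R ->
  a%:num%:E * f x + (1 - a%:num)%:E * q z <= f (x <| a |> z).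
Proof.
move=> fmin a0.
have qf b y w : (y <| b |> z <= w)%O ->
    b%:num%:E * q y + (1 - b%:num)%:E * q z <= f w.
  by move=> /fmin.1.2; apply: le_trans; exact: q_concave.
(* If q z is infinite and a < 1, then so is f (x +_a z). *)
have := q_ge0 z; case qz : (q z) => [r| |]// r0.
  rewrite -EFinM; apply: minimal_majorant_supports => // b y w b0 /qf.
  by rewrite qz.
have [aE|aE|/andP[_ a1]] := i01P a.
- by rewrite aE ltxx in a0.
- by rewrite aE conv1 /= mul1e subrr mul0e adde0.
have := qf a x _ (lexx _).
by rewrite qz ge0_addeMy ?subr_gt0 ?mule_ge0// leye_eq => /eqP ->; exact: leey.
Qed.

Lemma minimal_majorant_concave f : minimal_convex_majorant f -> concave_map f.
Proof.
move=> fmin; apply: concave_mapW => a x z /andP[a0 a1].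
have mixed b y : (b%:num < 1)%R ->
    b%:num%:E * q y + (1 - b%:num)%:E * f z <= f (y <| b |> z).
  move=> b1; rewrite convC addeC.
  have := minimal_majorant_conv_ge f (1 - b%:num)%:i01%R z y fmin.
  by rewrite /= subr_gt0 subKr; apply.
have := convex_majorant_ge0 f z fmin.1; case fz : (f z) => [r| |]// r0.
  rewrite -EFinM; apply: minimal_majorant_supports => // b y w b0 yw.
  apply: le_trans (minimal_majorant_nondecreasing f fmin _ _ yw).
  have [b1|b1] := eqVneq b 1%:i01%R.
    rewrite b1 conv1/= subrr mul0r mul1e adde0.
    exact: convex_majorant_ge fmin.1.
  rewrite EFinM -fz; apply: mixed.
  by rewrite lt_neqAle b1/=.
have := mixed a x a1.
by rewrite fz ge0_addeMy ?subr_gt0 ?mule_ge0// leye_eq => /eqP ->; exact: leey.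
Qed.

End minimal_majorant.

(** * The sandwich theorem *)

Theorem proposition8p1 (R : realType) (d : Order.disp_t)
    (B : preorderedBaryType d R) (p q : B -> \bar R)
    (p_ge0 : forall x : B, 0 <= p x) (q_ge0 : forall x : B, 0 <= q x)
    (p_convex : convex_map p) (q_concave : concave_map q) :
  [/\ dominated q p ->
        exists Lambda : B -> \bar R,
          [/\ forall x : B, 0 <= Lambda x,
              affine_map Lambda,
              Order.nondecreasing Lambda,
              forall x : B, q x <= Lambda x <= p x
            & forall bot : B, is_least bot -> strict_map bot p ->
                linear_map bot Lambda],
      (forall x : B, q x <= p x) ->
        Order.nondecreasing p \/ Order.nondecreasing q -> dominated q p
    & forall bot : B, is_least bot -> sublinear_map bot p -> strict_map bot p].
Proof.
split.
- move=> qp.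
  have p_maj : convex_majorant q p by [].
  have [f fmin fp] := exists_minimal_convex_majorant q q_ge0 p p_maj.
  have f_ge0 x : 0 <= f x := convex_majorant_ge0 q q_ge0 f x fmin.1.
  have f_affine : affine_map f.
    move=> a x y; apply/le_anti/andP; split; first exact: fmin.1.1.
    exact: (minimal_majorant_concave q).
  exists f; split=> //.
  + exact: (minimal_majorant_nondecreasing q).
  + by move=> x; rewrite fp (convex_majorant_ge q f x fmin.1).
  + move=> bot _ pbot.
    have fbot : f bot = 0 by apply/le_anti; rewrite f_ge0 -pbot fp.
    split=> // a x.
    by rewrite /pscale f_affine fbot mule0 adde0.
- move=> qp [pmono|qmono] x y xy.
  + exact: le_trans (qp x) (pmono _ _ xy).
  + exact: le_trans (qmono _ _ xy) (qp y).
- move=> bot _ [phom _].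
  by rewrite /strict_map -[X in p X](convmm 0%:i01%R) [LHS]phom mul0e.
Qed.
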